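(* Let $n\ge 1$, let $\alpha>1$ be real, and let $m\in\{j/2^n: 0\le j\le 2^n\}$ be fixed. For $\epsilon\in[0,1/2]$ and a Boolean function $f$, write $M_\epsilon(f)=\mathbb{E}(T_\epsilon f)^\alpha$, and let $\mathcal{B}_m$ be the set of Boolean functions $f:\{0,1\}^n\to\{0,1\}$ with $\mathbb{E} f=m$. (i) There exists $\epsilon_0\in(0,1/2]$ (depending on $n,\alpha,m$) such that for every $\epsilon\in(0,\epsilon_0)$, the lexicographic function $L_m\in\mathcal{B}_m$ satisfies $M_\epsilon(L_m)\ge M_\epsilon(f)$ for all $f\in\mathcal{B}_m$. (ii) There exists $\epsilon_1\in[0,1/2)$ (depending on $n,\alpha,m$) such that for every $\epsilon\in(\epsilon_1,1/2)$, every $f\in\mathcal{B}_m$ maximizing $M_\epsilon$ over $\mathcal{B}_m$ satisfies $W_1(f)=\max\{W_1(g): g\in\mathcal{B}_m\}$. (iii) If $m=1/2$, there exist $\epsilon_0\in(0,1/2]$ and $\epsilon_1\in[0,1/2)$ such that for every $\epsilon\in(0,\epsilon_0)\cup(\epsilon_1,1/2)$, the dictator function $d(x)=x_1$ satisfies $M_\epsilon(d)\ge M_\epsilon(f)$ for all $f\in\mathcal{B}_{1/2}$.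
   Context: $\{0,1\}^n$ carries the uniform probability measure; $\mathbb{E}$ denotes expectation with respect to it. A Boolean function is a map $f:\{0,1\}^n\to\{0,1\}$. For $0\le\epsilon\le 1/2$, the noise operator is $T_\epsilon f(x)=\mathbb{E} f(x+Z)$, where $Z\in\{0,1\}^n$ has independent Bernoulli($\epsilon$) coordinates and addition is coordinatewise mod 2. For $A\subseteq[n]$, $W_A(x)=(-1)^{\sum_{i\in A}x_i}$ and $\hat f(A)=\mathbb{E}(fW_A)$; the degree-1 Fourier weight of $f$ is $W_1(f)=\sum_{i=1}^n\hat f(\{i\})^2$. The lexicographic function $L_m$ of mean $m$ is the indicator of the set consisting of the first $m2^n$ elements of $\{0,1\}^n$ in lexicographic order. The dictator function is $d(x)=x_1$. *)

(* Defs.v *)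
From mathcomp Require Import all_boot all_order all_algebra.
From mathcomp Require Import reals exp.
Unset Printing Implicit Defensive.
Import Order.TTheory GRing.Theory Num.Theory.
Local Open Scope ring_scope.

(* The discrete cube {0,1}^n is n.-tuple bool; coordinate x_{i+1} is tnth x i. *)
Definition cube (n : nat) := (n.-tuple bool).

Definition boolfun (n : nat) := cube n -> bool.

Section Defs.
Variables (R : realType) (n : nat).

Definition cadd (x z : cube n) : cube n := [tuple tnth x i (+) tnth z i | i < n].

Definition Ex (g : cube n -> R) : R := (2%:R ^+ n)^-1 * \sum_(x : cube n) g x.

Definition bval (f : boolfun n) (x : cube n) : R := (f x)%:R.

Definition mean (f : boolfun n) : R := Ex (bval f).

Definition bern_weight (eps : R) (z : cube n) : R :=
  \prod_(i < n) (if tnth z i then eps else 1 - eps).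

Definition noise (eps : R) (f : boolfun n) (x : cube n) : R :=
  \sum_(z : cube n) bern_weight eps z * bval f (cadd x z).

Definition Mfun (alpha eps : R) (f : boolfun n) : R :=
  Ex (fun x => powR (noise eps f x) alpha).

Definition walsh (A : {set 'I_n}) (x : cube n) : R :=
  (-1) ^+ (\sum_(i in A) nat_of_bool (tnth x i))%N.

Definition fhat (f : boolfun n) (A : {set 'I_n}) : R :=
  Ex (fun x => bval f x * walsh A x).

Definition W1 (f : boolfun n) : R := \sum_(i < n) fhat f [set i] ^+ 2.

End Defs.

(* position of x in the lexicographic order of {0,1}^n (x_1 most significant,
   0 < 1): the integer with binary digits x_1 ... x_n *)
Definition lexrank (n : nat) (x : cube n) : nat :=
  \sum_(i < n) (nat_of_bool (tnth x i) * 2 ^ (n.-1 - i))%N.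

(* L_m for m = j / 2^n: indicator of the first j elements in lex order *)
Definition lexfun (n j : nat) : boolfun n := fun x => (lexrank n x < j)%N.

(* dictator d(x) = x_1 (meaningful for n >= 1) *)
Definition dictator (n : nat) : boolfun n := fun x => nth false x 0.

(* Main.v *)
Require Import Defs.
From mathcomp Require Import all_boot all_order all_algebra.
From mathcomp Require Import perm zify ring lra.
From mathcomp Require Import classical_sets reals topology normedtype derive.
From mathcomp Require Import realfun exp.
Set Implicit Arguments.
Unset Strict Implicit.
Unset Printing Implicit Defensive.
Import Order.TTheory GRing.Theory Num.Theory.

(* For small eps,
     2^n M_eps(f) = |f| - alpha * eps * |boundary of f| + o(eps),
   so only sets of minimal edge boundary compete with the lexicographic segment.
   These are all isometric to it, hence have the same M_eps: by induction on the
   dimension, an extremal set of at most (at least) half the cube lies in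
   (contains) a facet, because any other split along the first coordinate makes
   the superadditivity of the extremal edge count strict.
   For eps = (1 - rho) / 2 with rho small, T f = m + rho * l + O(rho^2), where l
   is the degree-1 part of f, and E (T f) = m, so
     M_eps(f) = m^alpha * (1 + alpha * (alpha - 1) / 2 * W_1(f) * rho^2 / m^2)
                + o(rho^2),
   and W_1 takes discrete values. For m = 1/2, E (f - 1/2 - l)^2 = 1/4 - W_1(f), so
   equality in W_1(f) <= 1/4 forces f to be a dictator or the negation of one. *)

(** * The edge-isoperimetric problem on the cube *)

(* [lexedges k] is the largest number of edges induced by k vertices of a cube;
   the recursion is the halving of an initial lexicographic segment along its
   last coordinate. *)
Fixpoint lexedges_rec (fuel k : nat) : nat :=
  if fuel is m.+1 then
    if (k <= 1)%N then 0
    else lexedges_rec m k./2 + lexedges_rec m (uphalf k) + k./2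
  else 0.

Definition lexedges (k : nat) := lexedges_rec k k.

(** Any fuel of at least [k] is enough, because both halves of a number [k >= 2] are smaller than
    [k]. *)
Lemma lexedges_fuel m k : (k <= m)%N -> lexedges_rec m k = lexedges k.
Proof.
rewrite /lexedges; move: m; elim/ltn_ind: k => k IH [|m] km.
  by move: km; case: k {IH}.
case: k IH km => [|[|k]] IH km; try by [case: m km].
have recE l : lexedges_rec l.+1 k.+2 =
    (lexedges_rec l k./2.+1 + lexedges_rec l (uphalf k).+1 + k./2.+1)%N by [].
have h1 : (k./2.+1 < k.+2)%N by lia.
have h2 : ((uphalf k).+1 < k.+2)%N by lia.
rewrite !recE (IH _ h1 m); last lia.
rewrite (IH _ h2 m); last lia.
rewrite (IH _ h1 k.+1); last lia.
by rewrite (IH _ h2 k.+1); last lia.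
Qed.

(** The unguarded recursion also holds for [k <= 1]: there [k./2 = 0], [uphalf k = k] and
    [lexedges k = 0]. *)
Lemma lexedgesE k :
  lexedges k = (lexedges k./2 + lexedges (uphalf k) + k./2)%N.
Proof.
case: k => [|[|k]] //.
rewrite -(@lexedges_fuel k.+1 k.+2./2) -1?(@lexedges_fuel k.+1 (uphalf k.+2)) //=; lia.
Qed.

Lemma lexedges_double k : lexedges k.*2 = (2 * lexedges k + k)%N.
Proof. by rewrite lexedgesE doubleK uphalf_double mul2n -addnn. Qed.

Lemma lexedges_doubleS k :
  lexedges k.*2.+1 = (lexedges k + lexedges k.+1 + k)%N.
Proof. by rewrite lexedgesE /= !uphalf_double doubleK. Qed.

(** The arithmetic core of the isoperimetric inequality: two parallel faces of sizes [a] and [b]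
    have at most [minn a b] edges between them. The induction halves both numbers and pairs the
    halves so that each pair adds up to a half of [a + b]. *)
Lemma lexedges_superadd a b :
  (lexedges a + lexedges b + minn a b <= lexedges (a + b))%N.
Proof.
have [N] := ubnP (a + b)%N; elim: N a b => // N IH a b.
have [abN|] := leqP (a + b)%N 1.
  by case: a b abN => [|[|a]] [|[|b]].
move=> ab1 abN.
rewrite -(odd_double_half a) -(odd_double_half b).
have := odd_double_half a; have := odd_double_half b.
move: (a./2) (b./2) (odd a) (odd b) => p q [] [] /= Eb Ea;
  rewrite ?add0n ?add1n ?lexedges_double ?lexedges_doubleS.
(* When both numbers are odd the halves are paired crosswise, [p] with [q.+1] and [p.+1] with [q],
   since both sums must equal [(p + q).+1]. *)
- have -> : (p.*2.+1 + q.*2.+1 = (p + q).+1.*2)%N by lia.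
  rewrite lexedges_double.
  have := IH p q.+1; have := IH p.+1 q.
  by rewrite addSn addnS; lia.
- have -> : (p.*2.+1 + q.*2 = (p + q).*2.+1)%N by lia.
  rewrite lexedges_doubleS.
  by have := IH p q; have := IH p.+1 q; rewrite addSn; lia.
- have -> : (p.*2 + q.*2.+1 = (p + q).*2.+1)%N by lia.
  rewrite lexedges_doubleS.
  by have := IH p q; have := IH p q.+1; rewrite addnS; lia.
- have -> : (p.*2 + q.*2 = (p + q).*2)%N by lia.
  rewrite lexedges_double.
  by have := IH p q; lia.
Qed.

(** Equality case of the superadditivity, realised by a full face of size [2 ^ d] with [x] points in
    the parallel face. *)
Lemma lexedges_exp2D d x : (x <= 2 ^ d)%N ->
  lexedges (2 ^ d + x) = (lexedges (2 ^ d) + lexedges x + x)%N.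
Proof.
elim: d x => [|d IH] x; first by case: x => [|[|x]].
rewrite expnS mul2n -(odd_double_half x).
move: (x./2) (odd x) => y [] /= xd; rewrite ?add0n ?add1n.
- have -> : ((2 ^ d).*2 + y.*2.+1 = (2 ^ d + y).*2.+1)%N by lia.
  rewrite !lexedges_doubleS lexedges_double -addnS !IH; lia.
- have -> : ((2 ^ d).*2 + y.*2 = (2 ^ d + y).*2)%N by lia.
  rewrite !lexedges_double IH; lia.
Qed.

(* In dimension d + 2, a set of at most half the cube whose two faces have sizes
   a > 2 ^ d and 0 < b cannot have the maximal number of edges; the next lemma is
   the dual fact for sets of at least half the cube. *)
Lemma lexedges_superadd_lt_small d a b :
  (2 ^ d < a)%N -> (0 < b)%N -> (a + b <= 2 * 2 ^ d)%N ->
  (lexedges a + lexedges b + b < lexedges (a + b))%N.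
Proof.
move=> da b0 abd.
(* Once a full block [2 ^ d] is split off, superadditivity for [a - 2 ^ d] and [b] leaves a surplus
   [minn (a - 2 ^ d) b], positive because both are. *)
have -> : (a + b = 2 ^ d + (a - 2 ^ d + b))%N by lia.
have {1}-> : (a = 2 ^ d + (a - 2 ^ d))%N by lia.
rewrite !lexedges_exp2D; try lia.
by have := lexedges_superadd (a - 2 ^ d) b; lia.
Qed.

Lemma lexedges_superadd_lt_large d a b :
  (2 ^ d <= a < 2 * 2 ^ d)%N -> (b < 2 ^ d)%N -> (2 * 2 ^ d <= a + b)%N ->
  (lexedges a + lexedges b + b < lexedges (a + b))%N.
Proof.
move=> /andP[da ad] bd abd.
set D := (2 ^ d)%N in da ad bd abd *.
have E1 : lexedges (a + b) =
    (lexedges (2 ^ d.+1) + lexedges (a + b - 2 * D) + (a + b - 2 * D))%N.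
  rewrite -lexedges_exp2D expnS -/D; last lia.
  by congr lexedges; lia.
have E2 : lexedges a = (lexedges D + lexedges (a - D) + (a - D))%N.
  rewrite -lexedges_exp2D -/D; last lia.
  by congr lexedges; lia.
have E3 : lexedges (a - D + b) =
    (lexedges D + lexedges (a + b - 2 * D) + (a + b - 2 * D))%N.
  rewrite -lexedges_exp2D -/D; last lia.
  by congr lexedges; lia.
have E4 : lexedges (2 ^ d.+1) = (2 * lexedges D + D)%N.
  by rewrite expnS mul2n lexedges_double.
(* The resulting gain is at least [D - (a - D) + minn (a - D) b], which exceeds [b] because
   [a < 2 * D] and [b < D]. *)
have := lexedges_superadd (a - D) b.
rewrite E1 E2 E3 E4; lia.
Qed.

(** * Splitting the cube along its first coordinate *)

Definition ccons n (b : bool) (x : cube n) : cube n.+1 := [tuple of b :: x].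

Lemma ccons_surj n (P : cube n.+1 -> Prop) :
  (forall b x, P (ccons b x)) -> forall x, P x.
Proof. by move=> Pc x; rewrite (tuple_eta x); exact: (Pc (thead x) [tuple of behead x]). Qed.

Lemma tnth_ccons0 n b (x : cube n) : tnth (ccons b x) ord0 = b.
Proof. exact: tnth0. Qed.

Lemma tnth_cconsS n b (x : cube n) i : tnth (ccons b x) (lift ord0 i) = tnth x i.
Proof. exact: tnthS. Qed.

(** The face taken first is a parameter [c], so that later arguments can start from the larger face
    without a case distinction. *)
Lemma big_ccons (T : Type) (idx : T) (op : Monoid.com_law idx) n
    (c : bool) (F : cube n.+1 -> T) :
  \big[op/idx]_x F x =
  op (\big[op/idx]_x F (ccons c x)) (\big[op/idx]_x F (ccons (~~ c) x)).
Proof.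
pose h (p : bool * cube n) := ccons p.1 p.2.
have hK : {on predT, bijective h}.
  exists (fun x => (thead x, [tuple of behead x])) => [[b x] _|x _].
    by congr pair; apply: val_inj.
  by rewrite [RHS]tuple_eta.
rewrite (reindex h hK) -(pair_bigA _ (fun b x => F (ccons b x))) /=.
by case: c; rewrite big_bool // Monoid.mulmC.
Qed.

Definition hdist n (x y : cube n) : nat :=
  \sum_(i < n) (tnth x i (+) tnth y i).

Lemma hdist_ccons n b c (x y : cube n) :
  hdist (ccons b x) (ccons c y) = ((b (+) c) + hdist x y)%N.
Proof.
rewrite /hdist big_ord_recl !tnth_ccons0; congr addn.
by apply: eq_bigr => i _; rewrite !tnth_cconsS.
Qed.

Lemma hdist_eq0 n (x y : cube n) : (hdist x y == 0) = (x == y).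
Proof.
rewrite sum_nat_eq0; apply/forallP/eqP => [xy|-> i]; last by rewrite addbb.
apply: eq_from_tnth => i; move: (xy i).
by case: (tnth x i); case: (tnth y i).
Qed.

Lemma hdist_le n (x y : cube n) : (hdist x y <= n)%N.
Proof.
rewrite -[leqRHS]card_ord -sum1_card; apply: leq_sum => i _.
by case: (_ (+) _).
Qed.

Definition size_of n (f : boolfun n) : nat := \sum_x (f x : nat).

(* Counts ordered adjacent pairs: twice the number of induced edges. *)
Definition edges2 n (f : boolfun n) : nat :=
  \sum_x \sum_y ((hdist x y == 1) && f x && f y : nat).

Definition face n (c : bool) (f : boolfun n.+1) : boolfun n :=
  fun x => f (ccons c x).

Definition fun_and n (f g : boolfun n) : boolfun n := fun x => f x && g x.

Lemma eq_size_of n (f g : boolfun n) : f =1 g -> size_of f = size_of g.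
Proof. by move=> fg; apply: eq_bigr => x _; rewrite fg. Qed.

Lemma eq_edges2 n (f g : boolfun n) : f =1 g -> edges2 f = edges2 g.
Proof.
by move=> fg; apply: eq_bigr => x _; apply: eq_bigr => y _; rewrite !fg.
Qed.

Lemma size_of_face n c (f : boolfun n.+1) :
  size_of f = (size_of (face c f) + size_of (face (~~ c) f))%N.
Proof. exact: big_ccons. Qed.

Lemma hdist_ccons_neg n c (x y : cube n) :
  (hdist (ccons c x) (ccons (~~ c) y) == 1) = (x == y).
Proof. by rewrite hdist_ccons addbN addbb add1n eqSS hdist_eq0. Qed.

(** An edge between the faces joins two points with the same remaining coordinates, so such edges
    correspond to the points common to both faces; the factor 2 counts both orders. *)
Lemma edges2_face n c (f : boolfun n.+1) :
  edges2 f = (edges2 (face c f) + edges2 (face (~~ c) f)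
              + 2 * size_of (fun_and (face c f) (face (~~ c) f)))%N.
Proof.
have H b : (\sum_x \sum_y ((hdist (ccons b x) y == 1) && f (ccons b x) && f y)
   = edges2 (face b f) + size_of (fun_and (face c f) (face (~~ c) f)))%N.
  rewrite /edges2 /size_of -big_split; apply: eq_bigr => x _ /=.
  rewrite (big_ccons _ b) /=; congr addn.
    by apply: eq_bigr => y _; rewrite hdist_ccons addbb.
  rewrite (bigD1 x) //= hdist_ccons_neg eqxx big1 => [|y /negPf yx].
    by rewrite addn0 /fun_and /face; case: b c => [] []; rewrite // andbC.
  by rewrite hdist_ccons_neg eq_sym yx.
by rewrite {1}/edges2 (big_ccons _ c) !H /=; lia.
Qed.

Lemma size_of_and n (f g : boolfun n) : (size_of (fun_and f g) <= size_of f)%N.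
Proof. by apply: leq_sum => x _; rewrite /fun_and; case: (f x); case: (g x). Qed.

Lemma size_of_andr n (f g : boolfun n) : (size_of (fun_and f g) <= size_of g)%N.
Proof. by apply: leq_sum => x _; rewrite /fun_and; case: (f x); case: (g x). Qed.

Lemma size_of_and_eq n (f g : boolfun n) :
  size_of (fun_and f g) = size_of g -> forall x, g x -> f x.
Proof.
move=> e x gx; apply: contraT => nfx.
suff : (size_of (fun_and f g) < size_of g)%N by rewrite e ltnn.
rewrite /size_of (bigD1 x) //= [ltnRHS](bigD1 x) //= /fun_and (negPf nfx) gx.
by rewrite add0n add1n ltnS leq_sum // => y _; case: (f y); case: (g y).
Qed.

Lemma size_of_max n (f : boolfun n) : (size_of f <= 2 ^ n)%N.
Proof.
rewrite -[2]card_bool -card_tuple -sum1_card; apply: leq_sum => x _.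
by case: (f x).
Qed.

Lemma size_of_eq0 n (f : boolfun n) : size_of f = 0 -> forall x, f x = false.
Proof.
by move=> /eqP; rewrite sum_nat_eq0 => /forallP f0 x; move: (f0 x); case: (f x).
Qed.

Lemma size_of_full n (f : boolfun n) : size_of f = (2 ^ n)%N -> forall x, f x.
Proof.
move=> e x; apply: (@size_of_and_eq _ f (fun _ => true)) => //.
rewrite (@eq_size_of _ _ f) ?e; last by move=> y; rewrite /fun_and andbT.
by rewrite /size_of sum_nat_const muln1 card_tuple card_bool.
Qed.

Lemma cube0 (x y : cube 0) : x = y.
Proof. by rewrite (tuple0 x) (tuple0 y). Qed.

(** Edge-isoperimetric inequality, by induction on the dimension: the edges between the faces are at
    most as many as the points of the smaller face, which is the room left by superadditivity. *)
Lemma edges2_le n (f : boolfun n) : (edges2 f <= 2 * lexedges (size_of f))%N.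
Proof.
elim: n f => [|n IH] f.
  rewrite /edges2 big1 // => x _; rewrite big1 // => y _.
  by rewrite /hdist big_ord0.
rewrite (edges2_face false) (size_of_face false).
have := lexedges_superadd (size_of (face false f)) (size_of (face true f)).
have := size_of_and (face false f) (face true f).
have := size_of_andr (face false f) (face true f).
by have := IH (face false f); have := IH (face true f) => /=; lia.
Qed.

(** * Rigidity of extremal sets *)

Definition edge_optimal n (f : boolfun n) := edges2 f = (2 * lexedges (size_of f))%N.

(** Equality in the induction step forces equality in each of its inequalities; a full count of
    crossing edges means that the smaller face is nested in the larger one. *)
Lemma edge_optimal_face n c (f : boolfun n.+1) :
  (size_of (face (~~ c) f) <= size_of (face c f))%N -> edge_optimal f ->
  [/\ edge_optimal (face c f), edge_optimal (face (~~ c) f),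
      forall x, face (~~ c) f x -> face c f x &
      lexedges (size_of f) = (lexedges (size_of (face c f))
        + lexedges (size_of (face (~~ c) f)) + size_of (face (~~ c) f))%N].
Proof.
rewrite /edge_optimal (edges2_face c) (size_of_face c) => ba.
have := lexedges_superadd (size_of (face c f)) (size_of (face (~~ c) f)).
have := size_of_andr (face c f) (face (~~ c) f).
have := edges2_le (face c f); have := edges2_le (face (~~ c) f).
move=> h1 h2 h3 h4 h5; split; try lia.
by apply: size_of_and_eq; lia.
Qed.

Lemma neq_negb (b c : bool) : b != c -> b = ~~ c.
Proof. by case: b; case: c. Qed.

Lemma larger_face n (f : boolfun n.+1) :
  exists c, (size_of (face (~~ c) f) <= size_of (face c f))%N.
Proof.
by have [h|h] := leqP (size_of (face false f)) (size_of (face true f));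
  [exists true | exists false; rewrite ltnW].
Qed.

Lemma optimal_sub_facet n (f : boolfun n.+1) :
  edge_optimal f -> (size_of f <= 2 ^ n)%N ->
  exists i c, forall x, f x -> tnth x i = c.
Proof.
elim: n f => [|n IH] f fo fs; have [c fc] := larger_face f.
  exists ord0, c; apply: ccons_surj => b x fbx; rewrite tnth_ccons0.
  apply/eqP; apply: contraT => bc.
  have : size_of (face (~~ c) f) = 0 by move: fs; rewrite (size_of_face c) expn0; lia.
  by move=> /size_of_eq0/(_ x); rewrite /face -(neq_negb bc) fbx.
have [oc onc sub E] := edge_optimal_face fc fo.
have [b0|b0] := posnP (size_of (face (~~ c) f)).
  exists ord0, c; apply: ccons_surj => b x fbx; rewrite tnth_ccons0.
  apply/eqP; apply: contraT => bc; move: b0 => /size_of_eq0/(_ x).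
  by rewrite /face -(neq_negb bc) fbx.
(* A facet that confines the larger face also confines the smaller one nested in it. *)
have [a2|a2] := leqP (size_of (face c f)) (2 ^ n).
  have [i [d fi]] := IH _ oc a2; exists (lift ord0 i), d.
  apply: ccons_surj => b x fbx; rewrite tnth_cconsS; apply: fi.
  have [<- //|bc] := eqVneq b c.
  by apply: sub; rewrite /face -(neq_negb bc).
have := lexedges_superadd_lt_small a2 b0.
by move: fs; rewrite -E (size_of_face c) expnS => h /(_ h); rewrite ltnn.
Qed.

Lemma optimal_sup_facet n (f : boolfun n.+1) :
  edge_optimal f -> (2 ^ n <= size_of f)%N ->
  exists i c, forall x, tnth x i = c -> f x.
Proof.
elim: n f => [|n IH] f fo fs; have [c fc] := larger_face f.
  exists ord0, c; apply: ccons_surj => b x; rewrite tnth_ccons0 => ->.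
  have : size_of (face c f) = (2 ^ 0)%N.
    have := size_of_max (face c f).
    by move: fs; rewrite (size_of_face c) expn0; lia.
  by move=> /size_of_full/(_ x).
have [oc onc sub E] := edge_optimal_face fc fo.
have [a2|a2] := leqP (2 ^ n.+1) (size_of (face c f)).
  exists ord0, c; apply: ccons_surj => b x; rewrite tnth_ccons0 => ->.
  have : size_of (face c f) = (2 ^ n.+1)%N.
    by apply/eqP; rewrite eqn_leq a2 size_of_max.
  by move=> /size_of_full/(_ x).
(* Dually, a facet contained in the smaller face is contained in the larger one by nesting. *)
have [b2|b2] := leqP (2 ^ n) (size_of (face (~~ c) f)).
  have [i [d fi]] := IH _ onc b2; exists (lift ord0 i), d.
  apply: ccons_surj => b x; rewrite tnth_cconsS => /fi.
  have [->|bc] := eqVneq b c; first exact: sub.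
  by rewrite /face -(neq_negb bc).
have := @lexedges_superadd_lt_large n (size_of (face c f)) (size_of (face (~~ c) f)).
move: fs a2 E; rewrite (size_of_face c) expnS => h a2 E H.
have ca : (2 ^ n <= size_of (face c f) < 2 * 2 ^ n)%N by lia.
by have := H ca b2 h; rewrite -E ltnn.
Qed.

(** * Isometries of the cube *)

Definition cube_isometry n (s : cube n -> cube n) :=
  forall x y, hdist (s x) (s y) = hdist x y.

Lemma isometry_inj n (s : cube n -> cube n) : cube_isometry s -> injective s.
Proof. by move=> si x y sxy; apply/eqP; rewrite -hdist_eq0 -si sxy hdist_eq0. Qed.

Lemma big_isometry (T : Type) (idx : T) (op : Monoid.com_law idx) n
    (s : cube n -> cube n) (F : cube n -> T) :
  cube_isometry s -> \big[op/idx]_x F x = \big[op/idx]_x F (s x).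
Proof. by move=> /isometry_inj/injF_bij sb; apply: reindex; apply: onW_bij. Qed.

Lemma size_of_isometry n s (f : boolfun n) : cube_isometry s ->
  size_of (f \o s) = size_of f.
Proof. by move=> si; rewrite [RHS]/size_of (big_isometry _ _ si). Qed.

Lemma edges2_isometry n s (f : boolfun n) : cube_isometry s ->
  edges2 (f \o s) = edges2 f.
Proof.
move=> si; rewrite [RHS]/edges2 (big_isometry _ _ si); apply: eq_bigr => x _.
by rewrite [RHS](big_isometry _ _ si); apply: eq_bigr => y _; rewrite si.
Qed.

(** Exchanging coordinates [0] and [i] and adding [c] everywhere turns the facet where coordinate
    [i] equals [c] into the one of first bit [false]. *)
Lemma facet_isometry n (i : 'I_n.+1) (c : bool) :
  exists2 s : cube n.+1 -> cube n.+1, cube_isometry s &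
    forall b x, tnth (s (ccons b x)) i = b (+) c.
Proof.
pose t := tperm ord0 i.
exists (fun x => [tuple tnth x (t k) (+) c | k < n.+1]) => [x y|b x].
  rewrite {2}/hdist (reindex_inj (@perm_inj _ t)); apply: eq_bigr => k _.
  by rewrite !tnth_mktuple -addbA [c (+) _]addbC -!addbA addbb addbF.
by rewrite tnth_mktuple tpermR tnth_ccons0.
Qed.

Lemma cons_isometry n (s : cube n -> cube n) : cube_isometry s ->
  exists2 s' : cube n.+1 -> cube n.+1, cube_isometry s' &
    forall b x, s' (ccons b x) = ccons b (s x).
Proof.
move=> si; pose s' (x : cube n.+1) := ccons (thead x) (s [tuple of behead x]).
have s'E b x : s' (ccons b x) = ccons b (s x).
  by congr ccons; congr s; apply: val_inj.
exists s' => //; apply: ccons_surj => b x; apply: ccons_surj => c y.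
by rewrite !s'E !hdist_ccons si.
Qed.

(** * Initial lexicographic segments *)

Lemma lexrank_ccons n b (x : cube n) :
  lexrank _ (ccons b x) = (b * 2 ^ n + lexrank _ x)%N.
Proof.
rewrite /lexrank big_ord_recl tnth_ccons0 subn0; congr addn.
apply: eq_bigr => i _; rewrite tnth_cconsS /=; congr (_ * 2 ^ _)%N.
by have := ltn_ord i; rewrite /bump; lia.
Qed.

Lemma lexrank_lt n (x : cube n) : (lexrank _ x < 2 ^ n)%N.
Proof.
elim: n x => [|n IH]; first by move=> x; rewrite /lexrank big_ord0.
by apply: ccons_surj => b x; rewrite lexrank_ccons expnS; have := IH x; case: b; lia.
Qed.

Lemma lexfun_ccons_small n k b (x : cube n) : (k <= 2 ^ n)%N ->
  lexfun _ k (ccons b x) = ~~ b && lexfun _ k x.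
Proof.
by rewrite /lexfun lexrank_ccons; have := lexrank_lt x; case: b => /=; lia.
Qed.

Lemma lexfun_ccons_large n k b (x : cube n) : (2 ^ n <= k)%N ->
  lexfun _ k (ccons b x) = ~~ b || lexfun _ (k - 2 ^ n) x.
Proof.
by rewrite /lexfun lexrank_ccons; have := lexrank_lt x; case: b => /=; lia.
Qed.

Lemma size_of_const n b : size_of (fun _ : cube n => b) = (b * 2 ^ n)%N.
Proof. by rewrite /size_of sum_nat_const card_tuple card_bool mulnC. Qed.

Lemma size_of_lexfun n k : (k <= 2 ^ n)%N -> size_of (lexfun n k) = k.
Proof.
elim: n k => [|n IH] k kn.
  rewrite (@eq_size_of _ _ (fun=> 0 < k)) ?size_of_const; first by lia.
  by move=> x; rewrite /lexfun /lexrank big_ord0.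
rewrite (size_of_face false) /=; have [kl|kl] := leqP k (2 ^ n).
  rewrite (eq_size_of (fun x => lexfun_ccons_small false x kl)).
  rewrite (eq_size_of (fun x => lexfun_ccons_small true x kl)) /=.
  by rewrite size_of_const addn0 IH.
have {}kl := ltnW kl.
rewrite (eq_size_of (fun x => lexfun_ccons_large false x kl)).
rewrite (eq_size_of (fun x => lexfun_ccons_large true x kl)) /=.
by rewrite size_of_const IH; move: kn; rewrite expnS; lia.
Qed.

(** One face of a segment is empty or full and the other is again a segment, so the count follows
    [lexedges_exp2D]. *)
Lemma lexfun_edge_optimal n k : (k <= 2 ^ n)%N -> edge_optimal (lexfun n k).
Proof.
move=> kn; rewrite /edge_optimal size_of_lexfun //.
elim: n k kn => [|n IH] k kn.
  have [->|->] : k = 0 \/ k = 1 by lia.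
    by rewrite /edges2 big1 // => x _; rewrite big1 // => y _; rewrite andbF.
  by rewrite /edges2 big1 // => x _; rewrite big1 // => y _; rewrite /hdist big_ord0.
have full : edges2 (fun _ : cube n => true) = (2 * lexedges (2 ^ n))%N.
  by rewrite -(IH _ (leqnn _)); apply: eq_edges2 => x; rewrite /lexfun lexrank_lt.
have empty : edges2 (fun _ : cube n => false) = 0.
  by rewrite /edges2 big1 // => x _; rewrite big1 // => y _; rewrite andbF.
rewrite (edges2_face false) /=; have [kl|kl] := leqP k (2 ^ n).
  rewrite (eq_edges2 (fun x => lexfun_ccons_small false x kl)).
  rewrite (eq_edges2 (fun x => lexfun_ccons_small true x kl)) /= empty.
  rewrite (@eq_size_of _ _ (fun=> false)) ?size_of_const ?IH //; first by lia.
  by move=> x; rewrite /fun_and /face (lexfun_ccons_small true) // andbF.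
have {}kl := ltnW kl.
rewrite (eq_edges2 (fun x => lexfun_ccons_large false x kl)).
rewrite (eq_edges2 (fun x => lexfun_ccons_large true x kl)) /= full.
rewrite (@eq_size_of _ _ (lexfun n (k - 2 ^ n))).
  rewrite IH ?size_of_lexfun; try (move: kn; rewrite expnS; lia).
  rewrite -[in RHS](subnKC kl) lexedges_exp2D; last by move: kn; rewrite expnS; lia.
  by lia.
by move=> x; rewrite /fun_and /face !lexfun_ccons_large.
Qed.

(** A symmetry carries the facet around (or inside) the set to the first coordinate; one face is
    then empty (or full), and induction straightens the other. *)
Lemma edge_optimal_isometric n (f : boolfun n) : edge_optimal f ->
  exists2 s, cube_isometry s & f \o s =1 lexfun _ (size_of f).
Proof.
elim: n f => [|n IH] f fo.
  exists id => // x; rewrite /lexfun /lexrank big_ord0 /=.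
  rewrite (@eq_size_of _ _ (fun=> f x)) ?size_of_const; first by case: (f x).
  by move=> y; rewrite (cube0 x y).
have iso s : cube_isometry s -> edge_optimal (f \o s).
  by move=> si; rewrite /edge_optimal edges2_isometry // size_of_isometry.
have [fs|/ltnW fs] := leqP (size_of f) (2 ^ n).
  have [i [c fi]] := optimal_sub_facet fo fs.
  have [s si sE] := facet_isometry i c.
  pose g := f \o s.
  have g1 x : face true g x = false.
    by apply/negP => /fi; rewrite sE; case: c {fi sE}.
  have s1 : size_of (face true g) = 0 by rewrite (eq_size_of g1) size_of_const.
  have [] := @edge_optimal_face n false g; rewrite ?s1 //=; first exact: iso.
  move=> /IH [t ti tE] _ _ _.
  (* The map [t] may act on both faces at once: the face of first bit [true] is empty and stays
     so. *)
  have [t' ti' tE'] := cons_isometry ti.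
  exists (s \o t') => [x y|]; first by rewrite /= si ti'.
  apply: ccons_surj => b x; rewrite lexfun_ccons_small //= tE'.
  have sf : size_of f = size_of (face false g).
    by rewrite -(size_of_isometry f si) (size_of_face false) /= s1 addn0.
  case: b => /=; first exact: g1.
  by rewrite sf -tE.
have [i [c fi]] := optimal_sup_facet fo fs.
have [s si sE] := facet_isometry i c.
pose g := f \o s.
have g1 x : face false g x = true by apply: fi; rewrite sE.
have s1 : size_of (face false g) = (2 ^ n)%N.
  by rewrite (eq_size_of g1) size_of_const mul1n.
have [] := @edge_optimal_face n false g; rewrite ?s1 //=.
- exact: size_of_max.
- exact: iso.
move=> _ /IH [t ti tE] _ _.
have [t' ti' tE'] := cons_isometry ti.
exists (s \o t') => [x y|]; first by rewrite /= si ti'.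
apply: ccons_surj => b x; rewrite lexfun_ccons_large //= tE'.
have sf : (size_of f - 2 ^ n)%N = size_of (face true g).
  by rewrite -(size_of_isometry f si) (size_of_face false) /= s1 addKn.
case: b => /=; last exact: g1.
by rewrite sf -tE.
Qed.

Local Open Scope ring_scope.

(** * Expansions of real powers *)

Section PowerExpansions.
Local Open Scope classical_set_scope.
Import numFieldNormedType.Exports.

Lemma powR1D_taylor1 (R : realType) (b d : R) : 0 < d ->
  exists2 r : R, 0 < r & forall u : R, `|u| < r ->
    `|powR (1 + u) b - 1 - b * u| <= d * `|u|.
Proof.
move=> d0.
have : is_derive (1 : R) 1 (@powR R ^~ b) (b * powR 1 (b - 1)).
  exact: is_derive1_powR.
rewrite powR1 mulr1 => [[dv Dv]].
have := dv; rewrite /derivable => /cvg_ex [l lP].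
have lb : l = b by rewrite -Dv; apply/esym/cvg_lim.
rewrite {}lb in lP.
move/cvgrPdist_le : lP => /(_ _ d0) /= [r r0 H].
exists r => // u ur.
have [->|u0] := eqVneq u 0.
  by rewrite addr0 powR1 subrr mulr0 subr0 normr0 mulr0.
have := H u; rewrite /= sub0r normrN => /(_ ur u0).
rewrite powR1 /GRing.scale /= mulr1 [u + 1]addrC => H'.
have -> : powR (1 + u) b - 1 - b * u =
   - (u * (b - u^-1 * (powR (1 + u) b - 1))) by field.
by rewrite normrN normrM mulrC ler_wpM2r.
Qed.

(** The remainder [F] has as derivative [a] times the first-order remainder for the exponent
    [a - 1], so the mean value theorem gains one power of [u]. *)
Lemma powR1D_taylor2 (R : realType) (a d : R) : 0 < d ->
  exists2 r : R, 0 < r & forall u : R, `|u| < r ->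
    `|powR (1 + u) a - 1 - a * u - a * (a - 1) / 2 * u ^+ 2| <= d * u ^+ 2.
Proof.
move=> d0; have a0 : 0 < `|a| + 1 by rewrite ltr_wpDl.
have [r r0 Hr] := @powR1D_taylor1 R (a - 1) (d / (`|a| + 1)) (divr_gt0 d0 a0).
(* The cap 1 keeps [1 + x] positive, where the power is differentiable. *)
exists (Num.min r 1); first by rewrite lt_min r0 ltr01.
move=> u; rewrite lt_min => /andP[ur u1].
pose F (x : R) := powR (1 + x) a - 1 - a * x - a * (a - 1) / 2 * x ^+ 2.
pose dF (x : R) := a * (powR (1 + x) (a - 1) - 1 - (a - 1) * x).
have FdF (x : R) : - 1 < x -> is_derive x 1 F (dF x).
  move=> x1; have x10 : 0 < 1 + x by lra.
  have D1 : is_derive x 1 (fun y : R => 1 + y) 1.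
    by apply: is_derive_eq; rewrite add0r mulr1.
  have D2 : is_derive x 1 (fun y : R => powR (1 + y) a) (a * powR (1 + x) (a - 1)).
    have := @is_derive1_comp R (@powR R ^~ a) (fun y : R => 1 + y) x _ _
      (is_derive1_powR a x10) D1.
    by rewrite mulr1.
  by rewrite /F; apply: is_derive_eq; rewrite /dF /GRing.scale /=; field.
have F0 : F 0 = 0 by rewrite /F addr0 powR1 expr0n /= !mulr0 !subr0 subrr.
have cont (x : R) : - 1 < x -> F @ x --> F x.
  move=> /FdF [dx _]; apply: differentiable_continuous; exact/derivable1_diffP.
suff [x xu Fx] : exists2 x : R, `|x| <= `|u| & F u = dF x * u.
  rewrite -/(F u) Fx normrM.
  have : `|dF x| <= d * `|u|.
    rewrite normrM.
    have xr : `|x| < r by apply: le_lt_trans ur.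
    apply: (@le_trans _ _ (`|a| * (d / (`|a| + 1) * `|u|))).
      apply: ler_wpM2l => //; apply: le_trans (Hr _ xr) _.
      by rewrite ler_wpM2l // divr_ge0 // ltW.
    rewrite mulrA ler_wpM2r // mulrCA ger_pMr // ler_pdivrMr // mul1r.
    by rewrite lerDl.
  move=> /(ler_wpM2r (normr_ge0 u)) /le_trans; apply.
  by rewrite -mulrA -expr2 real_normK ?num_real.
move: u1; rewrite ltr_norml => /andP[u1 u2].
have [u0|u0|->] := ltgtP u 0; last by exists 0 => //; rewrite F0 mulr0.
  have [|||x xI] := @MVT R F dF u 0 => //.
  - by move=> x; rewrite in_itv /= => /andP[ux _]; apply: FdF; lra.
  - apply: continuous_in_subspaceT => x; rewrite inE /= in_itv /= => /andP[ux _].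
    by apply: cont; lra.
  rewrite F0 !sub0r mulrN => /oppr_inj Fu; exists x => //.
  move: xI; rewrite in_itv /= => /andP[xu x0].
  by rewrite !ltr0_norm //; lra.
have [|||x xI] := @MVT R F dF 0 u => //.
- by move=> x; rewrite in_itv /= => /andP[ux _]; apply: FdF; lra.
- apply: continuous_in_subspaceT => x; rewrite inE /= in_itv /= => /andP[ux _].
  by apply: cont; lra.
rewrite F0 !subr0 => Fu; exists x => //.
move: xI; rewrite in_itv /= => /andP[xu x0].
by rewrite !gtr0_norm //; lra.
Qed.

(** Meant for points outside the set, where the noisy value is of order [e]: the factor
    [powR t (a - 1)] tends to 0, so they contribute only o(e). *)
Lemma powR_le_small (R : realType) (a d : R) : 1 < a -> 0 < d ->
  exists2 r : R, 0 < r & forall t : R, 0 <= t -> t < r -> powR t a <= d * t.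
Proof.
move=> a1 d0; have a10 : 0 < a - 1 by lra.
exists (powR d (a - 1)^-1); first exact: powR_gt0.
move=> t t0 tr; rewrite -mulr_powRB1 //; last by lra.
rewrite mulrC ler_wpM2r //.
have -> : d = powR (powR d (a - 1)^-1) (a - 1).
  by rewrite -powRrM mulVf ?powRr1 ?ltW // lt0r_neq0.
by apply: ge0_ler_powR; rewrite ?nnegrE ?powR_ge0 // ltW.
Qed.

End PowerExpansions.

(** * Low noise *)

Section Expectation.
Variables (R : realType) (n : nat).
Implicit Types g h : cube n -> R.
Local Notation Ex := (Ex R n).

Lemma card_cube : #|{: cube n}| = (2 ^ n)%N.
Proof. by rewrite card_tuple card_bool. Qed.

Lemma ExD g h : Ex (fun x => g x + h x) = Ex g + Ex h.
Proof. by rewrite /Ex big_split mulrDr. Qed.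

Lemma ExZ a g : Ex (fun x => a * g x) = a * Ex g.
Proof. by rewrite /Ex -mulr_sumr mulrCA. Qed.

Lemma Ex_cst a : Ex (fun=> a) = a.
Proof.
by rewrite /Ex sumr_const card_cube -[a *+ _]mulr_natl natrX mulKf ?lt0r_neq0 ?exprn_gt0 ?ltr0n.
Qed.

Lemma eq_Ex g h : g =1 h -> Ex g = Ex h.
Proof. by move=> gh; congr (_ * _); apply: eq_bigr. Qed.

Lemma ExB g h : Ex (fun x => g x - h x) = Ex g - Ex h.
Proof.
rewrite -mulN1r -ExZ -ExD; apply: eq_Ex => x; by rewrite mulN1r.
Qed.

Lemma ler_Ex g h : (forall x, g x <= h x) -> Ex g <= Ex h.
Proof. by move=> gh; rewrite ler_wpM2l ?invr_ge0 ?exprn_ge0 // ler_sum. Qed.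

Lemma Ex_norm_le g a : (forall x, `|g x| <= a) -> `|Ex g| <= a.
Proof.
move=> ga; rewrite ler_norml -{1}[a]Ex_cst -{2}[a]Ex_cst.
rewrite -mulN1r -ExZ !ler_Ex // => x; have := ga x;
  by rewrite ler_norml ?mulN1r => /andP[].
Qed.

Lemma Ex_sum (I : Type) (r : seq I) (F : I -> cube n -> R) :
  Ex (fun x => \sum_(i <- r) F i x) = \sum_(i <- r) Ex (F i).
Proof. by rewrite /Ex exchange_big mulr_sumr. Qed.

End Expectation.

(** * The noise operator as a kernel *)

Section Noise.
Variables (R : realType) (n : nat).
Implicit Types (f g : boolfun n) (x y : cube n) (e : R).

Definition kernel e x y : R :=
  \prod_(i < n) (if tnth x i (+) tnth y i then e else 1 - e).

Lemma caddK x : involutive (cadd n x).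
Proof.
by move=> z; apply: eq_from_tnth => i; rewrite !tnth_mktuple addbA addbb.
Qed.

Lemma noiseE e f x : noise R n e f x = \sum_y kernel e x y * bval R n f y.
Proof.
rewrite /noise (reindex_inj (can_inj (caddK x))); apply: eq_bigr => y _.
rewrite caddK; congr (_ * _); apply: eq_bigr => i _; by rewrite tnth_mktuple.
Qed.

(** Dependence on the Hamming distance alone is what makes [Mfun] invariant under isometries. *)
Lemma kernelE e x y :
  kernel e x y = e ^+ hdist x y * (1 - e) ^+ (n - hdist x y)%N.
Proof.
have -> : (n - hdist x y = \sum_(i < n) (1 - (tnth x i (+) tnth y i)))%N.
  by rewrite sumnB ?sum1_card ?card_ord // => i _; case: (_ (+) _).
rewrite -!prodrXr -big_split; apply: eq_bigr => i _ /=.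
by case: (_ (+) _); rewrite ?expr0 ?expr1 ?mulr1 ?mul1r.
Qed.

Lemma kernel_ge0 e x y : 0 <= e <= 1 -> 0 <= kernel e x y.
Proof. by move=> /andP[e0 e1]; rewrite kernelE mulr_ge0 // exprn_ge0 // subr_ge0. Qed.

Lemma noise_ge0 e f x : 0 <= e <= 1 -> 0 <= noise R n e f x.
Proof.
by move=> e01; rewrite noiseE sumr_ge0 // => y _; rewrite mulr_ge0 ?kernel_ge0.
Qed.

Lemma eq_noise e f g x : f =1 g -> noise R n e f x = noise R n e g x.
Proof. by move=> fg; rewrite !noiseE; apply: eq_bigr => y _; rewrite /bval fg. Qed.

Lemma eq_Mfun a e f g : f =1 g -> Mfun R n a e f = Mfun R n a e g.
Proof. by move=> fg; apply: eq_Ex => x; rewrite (eq_noise _ _ fg). Qed.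

Lemma noise_isometry e s f x : cube_isometry s ->
  noise R n e (f \o s) x = noise R n e f (s x).
Proof.
move=> si; rewrite !noiseE [RHS](big_isometry _ _ si); apply: eq_bigr => y _.
by rewrite !kernelE si.
Qed.

Lemma Mfun_isometry a e s f : cube_isometry s ->
  Mfun R n a e (f \o s) = Mfun R n a e f.
Proof.
move=> si; rewrite /Mfun /Ex [in RHS](big_isometry _ _ si).
by congr (_ * _); apply: eq_bigr => x _; rewrite noise_isometry.
Qed.

Lemma meanE f : mean R n f = (size_of f)%:R / 2 ^+ n.
Proof. by rewrite /mean /Ex natr_sum mulrC. Qed.

Lemma mean_eq f k : (mean R n f = k%:R / 2 ^+ n) <-> size_of f = k.
Proof.
rewrite meanE; split=> [/(mulIf _)|-> //].
by rewrite invr_eq0 lt0r_neq0 ?exprn_gt0 ?ltr0n // => /(_ isT)/eqP; rewrite eqr_nat => /eqP.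
Qed.

End Noise.

Lemma kernel_suml (R : realType) n (e : R) (y : cube n) :
  \sum_x kernel e x y = 1.
Proof.
elim: n y => [|n IH].
  move=> y; rewrite (big_pred1 y) => [|x]; first by rewrite /kernel big_ord0.
  by rewrite (cube0 x y) /= eqxx.
have kS b c (x y : cube n) : kernel e (ccons b x) (ccons c y) =
    (if b (+) c then e else 1 - e) * kernel e x y.
  rewrite /kernel big_ord_recl !tnth_ccons0; congr (_ * _).
  by apply: eq_bigr => i _; rewrite !tnth_cconsS.
apply: ccons_surj => c y; rewrite (big_ccons _ c) /=.
under eq_bigr do rewrite kS; under [X in _ + X]eq_bigr do rewrite kS.
by rewrite -!mulr_sumr IH !mulr1 addbb addNb addbb /=; ring.
Qed.

Lemma Ex_noise (R : realType) n (e : R) (f : boolfun n) :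
  Ex R n (noise R n e f) = mean R n f.
Proof.
rewrite /mean /Ex; congr (_ * _).
under eq_bigr do rewrite noiseE.
rewrite exchange_big; apply: eq_bigr => y _ /=.
by rewrite -mulr_suml kernel_suml mul1r.
Qed.

Lemma expr1B_bounds (R : realType) (e : R) k : 0 <= e <= 1 ->
  1 - k%:R * e <= (1 - e) ^+ k <= 1 - k%:R * e + k%:R ^+ 2 * e ^+ 2.
Proof.
move=> /andP[e0 e1]; elim: k => [|k /andP[IH1 IH2]].
  by rewrite expr0 !mul0r subr0 expr0n /= mul0r addr0 lexx.
have k0 : 0 <= k%:R :> R by [].
rewrite exprS -natr1; apply/andP; split.
  apply: le_trans (ler_wpM2l _ IH1); last by rewrite subr_ge0.
  by nra.
apply: le_trans (ler_wpM2l _ IH2) _; first by rewrite subr_ge0.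
have : 0 <= k%:R ^+ 2 * e ^+ 3 by rewrite mulr_ge0 ?exprn_ge0.
have : 0 <= e ^+ 2 by rewrite exprn_ge0.
by nra.
Qed.

Section LowNoise.
Variables (R : realType) (n : nat).
Implicit Types (f g : boolfun n) (x y : cube n) (e : R).

(** At first order only distances 0 and 1 survive; farther points carry a factor [e ^+ 2]. *)
Lemma kernel_low e x y : 0 <= e <= 1 ->
  `|kernel e x y - ((x == y)%:R * (1 - n%:R * e) + (hdist x y == 1)%:R * e)|
    <= (n%:R ^+ 2 + 1) * e ^+ 2.
Proof.
move=> e01; have /andP[e0 e1] := e01; rewrite kernelE -hdist_eq0.
have n0 : 0 <= n%:R :> R by [].
have e20 : 0 <= e ^+ 2 by rewrite exprn_ge0.
have ne20 : 0 <= n%:R ^+ 2 * e ^+ 2 by rewrite mulr_ge0 ?exprn_ge0.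
have := hdist_le x y; case: (hdist x y) => [|[|d]] dn.
- rewrite eqxx /= subn0 mul1r mul0r addr0 mul1r.
  have /andP[h1 h2] := expr1B_bounds n e01.
  by rewrite ger0_norm; lra.
- rewrite /= mul0r add0r mul1r expr1.
  have /andP[h1 _] := expr1B_bounds (n - 1) e01.
  have h2 : (1 - e) ^+ (n - 1) <= 1 by rewrite exprn_ile1 //; lra.
  rewrite -[X in _ - X]mulr1 -mulrBr normrM ger0_norm // distrC ger0_norm ?subr_ge0 //.
  have nn : (n - 1)%:R <= n%:R ^+ 2 :> R by rewrite -natrX ler_nat; nia.
  have : e * (1 - (1 - e) ^+ (n - 1)) <= e * ((n - 1)%:R * e).
    by rewrite ler_wpM2l //; lra.
  have : e * ((n - 1)%:R * e) <= n%:R ^+ 2 * e ^+ 2.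
    by rewrite mulrCA expr2 ler_wpM2r // mulr_ge0.
  by lra.
- rewrite /= !mul0r addr0 subr0 ger0_norm; last by rewrite mulr_ge0 ?exprn_ge0 ?subr_ge0.
  have h2 : (1 - e) ^+ (n - d.+2) <= 1 by rewrite exprn_ile1 //; lra.
  have h3 : e ^+ d <= 1 by rewrite exprn_ile1.
  apply: (@le_trans _ _ (e ^+ 2)); last by lra.
  rewrite -[d.+2]addn2 exprD -mulrA mulrCA -[leRHS]mulr1.
  rewrite ler_wpM2l // mulr_ile1 ?exprn_ge0 //; first lra.
  by rewrite addn2.
Qed.

Definition nbrs f x : nat := \sum_y ((hdist x y == 1) && f y).

Lemma noise_low e f x : 0 <= e <= 1 ->
  `|noise R n e f x - ((f x)%:R * (1 - n%:R * e) + (nbrs f x)%:R * e)|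
    <= 2 ^+ n * (n%:R ^+ 2 + 1) * e ^+ 2.
Proof.
move=> e01.
have -> : (f x)%:R * (1 - n%:R * e) + (nbrs f x)%:R * e =
    \sum_y ((x == y)%:R * (1 - n%:R * e) + (hdist x y == 1)%:R * e) * bval R n f y.
  under eq_bigr do rewrite mulrDl.
  rewrite big_split /=; congr (_ + _).
    rewrite (bigD1 x) //= eqxx mul1r big1 ?addr0 1?mulrC // => y /negPf yx.
    by rewrite eq_sym yx !mul0r.
  rewrite natr_sum mulr_suml; apply: eq_bigr => y _.
  by rewrite /bval -mulrA [e * _]mulrC mulrA -natrM mulnb.
rewrite noiseE -sumrB; apply: le_trans (ler_norm_sum _ _ _) _.
have -> : 2 ^+ n * (n%:R ^+ 2 + 1) * e ^+ 2 =
    \sum_(y : cube n) (n%:R ^+ 2 + 1) * e ^+ 2.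
  by rewrite sumr_const card_cube -[RHS]mulr_natl natrX mulrA.
rewrite ler_sum // => y _.
rewrite -mulrBl normrM; apply: le_trans (kernel_low x y e01).
by rewrite ler_piMr // normr_nat /bval; case: (f y).
Qed.

Lemma nbrs_le f x : (nbrs f x <= 2 ^ n)%N.
Proof.
rewrite -card_cube -sum1_card; apply: leq_sum => y _; by case: (_ && _).
Qed.

(** Inside the set the noisy value is near 1 and the first-order expansion applies; outside it is
    O(e), and its power is o(e). *)
Lemma powR_noise_low a d : 1 < a -> 0 < d ->
  exists2 r : R, 0 < r & forall e, 0 < e < r -> forall f x,
    `|powR (noise R n e f x) a - (f x)%:R * (1 - a * e * (n%:R - (nbrs f x)%:R))|
      <= d * e.
Proof.
(* [K0] is the constant of [noise_low]; [K * e] bounds the distance from the noisy value to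
   [f x]. *)
move=> a1 d0; pose K0 : R := 2 ^+ n * (n%:R ^+ 2 + 1).
pose K : R := n%:R + 2 ^+ n + K0 + 1.
have n0 : 0 <= n%:R :> R by [].
have K00 : 0 < K0 by rewrite mulr_gt0 ?exprn_gt0 // ltr_wpDl ?exprn_ge0.
have P0 : 0 < 2 ^+ n :> R by rewrite exprn_gt0.
have KK : K0 < K by rewrite /K; lra.
have K1 : 0 < K by lra.
have d'0 : 0 < d / (2 * K) by rewrite divr_gt0 // mulr_gt0.
have [r1 r10 H1] := powR1D_taylor1 a d'0.
have [r2 r20 H2] := powR_le_small a1 d'0.
(* The bounds with [r1] and [r2] bring [K * e] into the ranges of the two power estimates; the last
   one makes [a * K0 * e ^+ 2] at most [d / 2 * e]. *)
pose r := Num.min 1 (Num.min (r1 / K) (Num.min (r2 / K) (d / (2 * a * K0)))).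
have a0 : 0 < a by lra.
have aK0 : 0 < 2 * a * K0 by rewrite mulr_gt0 // mulr_gt0.
exists r; first by rewrite !lt_min ltr01 !divr_gt0.
move=> e; rewrite !lt_min => /andP[e0 /and4P[e1]].
rewrite !ltr_pdivlMr //.
move=> er1 er2 er3 f x.
have e01 : 0 <= e <= 1 by rewrite !ltW.
have := noise_low f x e01; have N0 := noise_ge0 f x e01.
have c0 : 0 <= (nbrs f x)%:R :> R by [].
have cP : (nbrs f x)%:R <= 2 ^+ n :> R by rewrite -natrX ler_nat nbrs_le.
rewrite -/K0; move: (noise R n e f x) N0 (nbrs f x)%:R c0 cP => N N0 c c0 cP.
have ee : e ^+ 2 <= e by rewrite expr2; nra.
have Kee : K0 * e ^+ 2 <= K0 * e by rewrite ler_wpM2l // ltW.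
case: (f x) => /=.
  rewrite !mul1r => HN.
  have uE : N = 1 + (N - 1) by lra.
  have uK : `|N - 1| <= K * e.
    move: HN; rewrite !ler_norml /K => /andP[h1 h2].
    have : 0 <= n%:R * e by rewrite mulr_ge0 // ltW.
    have : 0 <= c * e <= 2 ^+ n * e by rewrite mulr_ge0 ?ler_wpM2r // ltW.
    by move=> /andP[]; rewrite !mulrDl mul1r; lra.
  have := H1 (N - 1); rewrite -uE => /(_ (le_lt_trans uK _)).
  rewrite mulrC => /(_ er1) HT.
  have HT' : d / (2 * K) * `|N - 1| <= d / 2 * e.
    apply: le_trans (ler_wpM2l (ltW d'0) uK) _.
    by rewrite le_eqVlt; apply/orP; left; apply/eqP; field; rewrite lt0r_neq0.
  have -> : powR N a - (1 - a * e * (n%:R - c)) =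
     (powR N a - 1 - a * (N - 1)) + a * (N - (1 - n%:R * e + c * e)) by ring.
  apply: le_trans (ler_normD _ _) _.
  rewrite normrM (ger0_norm (_ : 0 <= a)); last by lra.
  have : a * `|N - (1 - n%:R * e + c * e)| <= a * (K0 * e ^+ 2).
    by rewrite ler_wpM2l //; lra.
  have : a * (K0 * e ^+ 2) <= d / 2 * e.
    by have := ler_wpM2r (ltW e0) (ltW er3); rewrite expr2; lra.
  by lra.
rewrite !mul0r add0r subr0 => HN.
have NK : N <= K * e.
  move: HN; rewrite ler_norml /K => /andP[h1 h2].
  have : 0 <= n%:R * e by rewrite mulr_ge0 // ltW.
  have : 0 <= c * e <= 2 ^+ n * e by rewrite mulr_ge0 ?ler_wpM2r // ltW.
  by move=> /andP[]; rewrite !mulrDl mul1r; lra.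
rewrite ger0_norm ?powR_ge0 //.
have := H2 N N0; rewrite mulrC in er2 => /(_ (le_lt_trans NK er2)) => h.
apply: le_trans h _; apply: le_trans (ler_wpM2l (ltW d'0) NK) _.
have -> : d / (2 * K) * (K * e) = d / 2 * e by field; rewrite lt0r_neq0.
by rewrite ler_wpM2r ?ltW //; lra.
Qed.

Lemma edges2_nbrs f : edges2 f = (\sum_x f x * nbrs f x)%N.
Proof.
apply: eq_bigr => x _; rewrite /nbrs big_distrr /=; apply: eq_bigr => y _.
by rewrite mulnb andbCA andbA.
Qed.

Lemma Mfun_low a : 1 < a ->
  exists2 r : R, 0 < r & forall e, 0 < e < r -> forall f g,
    size_of f = size_of g -> (edges2 f < edges2 g)%N ->
    Mfun R n a e f <= Mfun R n a e g.
Proof.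
move=> a1; have P0 : 0 < 2 ^+ n :> R by rewrite exprn_gt0.
(* Over the [2 ^ n] points the errors add up to [a / 2 * e] for each function, together no more than
   the [a * e] that one unit of [edges2] is worth. *)
pose d := a / (2 * 2 ^+ n).
have d0 : 0 < d by rewrite divr_gt0 // ?mulr_gt0 //; lra.
have [r r0 H] := powR_noise_low a1 d0.
exists r => // e er f g sfg efg.
have /andP[e0 _] := er.
have S h : `|\sum_x powR (noise R n e h x) a -
    ((size_of h)%:R * (1 - a * e * n%:R) + a * e * (edges2 h)%:R)| <= a / 2 * e.
  have -> : (size_of h)%:R * (1 - a * e * n%:R) + a * e * (edges2 h)%:R =
      \sum_x (h x)%:R * (1 - a * e * (n%:R - (nbrs h x)%:R)).
    rewrite edges2_nbrs !natr_sum mulr_suml mulr_sumr -big_split.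
    by apply: eq_bigr => x _; rewrite /= natrM; ring.
  rewrite -sumrB; apply: le_trans (ler_norm_sum _ _ _) _.
  apply: le_trans (ler_sum _ (fun x _ => H e er h x)) _.
  rewrite sumr_const card_cube -[_ *+ _]mulr_natl natrX /d.
  by rewrite le_eqVlt; apply/orP; left; apply/eqP; field; rewrite lt0r_neq0.
rewrite /Mfun /Ex ler_wpM2l ?invr_ge0 ?(ltW P0) //.
have := S f; have := S g; rewrite sfg !ler_norml => /andP[h1 h2] /andP[h3 h4].
have : a * e * ((edges2 f)%:R + 1) <= a * e * (edges2 g)%:R.
  rewrite ler_wpM2l ?mulr_ge0 //; [lra|lra|].
  by rewrite natr1 ler_nat.
by lra.
Qed.

End LowNoise.

(** * High noise *)

(** Each new factor at most doubles the error and adds at most [size r * rho ^+ 2], so [4 ^+ size r]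
    grows fast enough. *)
Lemma prod1D_approx (R : realType) (I : Type) (r : seq I) (s : I -> R) (rho : R) :
  0 <= rho <= 1 -> (forall i, `|s i| <= 1) ->
  `|\prod_(i <- r) (1 + rho * s i) - 1 - rho * \sum_(i <- r) s i|
    <= 4 ^+ size r * rho ^+ 2.
Proof.
move=> /andP[rho0 rho1] s1; have r20 : 0 <= rho ^+ 2 by rewrite exprn_ge0.
elim: r => [|i r IH].
  by rewrite !big_nil subrr mulr0 subr0 normr0 expr0 mul1r.
rewrite !big_cons /= exprS.
have : `|\sum_(j <- r) s j| <= (size r)%:R.
  elim: (r) => [|j t IHt]; first by rewrite big_nil normr0.
  rewrite big_cons /= -natr1 addrC; apply: le_trans (ler_normD _ _) _.
  by rewrite lerD.
move: IH; set p := \prod_(_ <- _) _; set S := \sum_(_ <- _) _ => IH Sk.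
have -> : (1 + rho * s i) * p - 1 - rho * (s i + S) =
    (1 + rho * s i) * (p - 1 - rho * S) + s i * S * rho ^+ 2 by ring.
apply: le_trans (ler_normD _ _) _.
rewrite [`|_ * rho ^+ 2|]normrM (ger0_norm r20) [`|s i * S|]normrM [`|_ * (p - _ - _)|]normrM.
have h1 : `|1 + rho * s i| <= 2.
  apply: le_trans (ler_normD _ _) _; rewrite normr1 normrM ger0_norm //.
  have : rho * `|s i| <= 1 by rewrite mulr_ile1.
  by lra.
have h2 : `|1 + rho * s i| * `|p - 1 - rho * S| <= 2 * (4 ^+ size r * rho ^+ 2).
  by rewrite ler_pM.
have h3 : `|s i| * `|S| <= (size r)%:R by rewrite -[leRHS]mul1r ler_pM.
have h4 : (size r)%:R <= 4 ^+ size r :> R.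
  by rewrite -natrX ler_nat ltnW // ltn_expl.
have : `|s i| * `|S| * rho ^+ 2 <= 4 ^+ size r * rho ^+ 2.
  by rewrite ler_wpM2r // (le_trans h3).
have : 0 <= 4 ^+ size r * rho ^+ 2 by rewrite mulr_ge0 ?exprn_ge0.
by rewrite -mulrA; lra.
Qed.

Section HighNoise.
Variables (R : realType) (n : nat).
Implicit Types (f g : boolfun n) (x y : cube n) (i k : 'I_n) (rho a : R).
Local Notation Ex := (Ex R n).

Definition chi i x : R := (-1) ^+ (tnth x i).

Definition fhat1 f i : R := fhat R n f [set i].

Definition linpart f x : R := \sum_i fhat1 f i * chi i x.

Lemma fhat1E f i : fhat1 f i = Ex (fun x => bval R n f x * chi i x).
Proof. by apply: eq_Ex => x; rewrite /walsh big_set1. Qed.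

Lemma chi_sqr i x : chi i x * chi i x = 1.
Proof. by rewrite -expr2 sqrr_sign. Qed.

Lemma chi_norm i x : `|chi i x| = 1.
Proof. exact: normr_sign. Qed.

(** This reflection negates [chi i] and fixes the other [chi k], so expectations odd under it
    vanish. *)
Definition flip i x : cube n := [tuple tnth x k (+) (k == i) | k < n].

Lemma flip_isometry i : cube_isometry (flip i).
Proof.
move=> x y; apply: eq_bigr => k _.
by rewrite !tnth_mktuple -addbA [(k == i) (+) _]addbC -!addbA addbb addbF.
Qed.

Lemma chi_flip i k x : chi k (flip i x) = (if k == i then -1 else 1) * chi k x.
Proof.
rewrite /chi tnth_mktuple; case: (k == i); last by rewrite addbF mul1r.
by case: (tnth x k); rewrite /= ?expr0 ?expr1; ring.
Qed.

Lemma Ex_flip i (h : cube n -> R) : Ex h = Ex (h \o flip i).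
Proof. by rewrite /Defs.Ex (big_isometry _ _ (flip_isometry i)). Qed.

Lemma Ex_chi i k : Ex (fun x => chi i x * chi k x) = (i == k)%:R.
Proof.
have [->|ik] := eqVneq i k.
  by rewrite -[RHS](Ex_cst n); apply: eq_Ex => x; rewrite chi_sqr.
have : Ex (fun x => chi i x * chi k x) = - Ex (fun x => chi i x * chi k x).
  rewrite {1}(Ex_flip i) -mulN1r -ExZ; apply: eq_Ex => x /=.
  by rewrite !chi_flip eqxx eq_sym (negPf ik) mul1r mulrA.
by rewrite mulr0n; lra.
Qed.

(** Parseval for the degree-1 part, from the orthonormality of the [chi i]. *)
Lemma Ex_linpart_sqr f : Ex (fun x => linpart f x ^+ 2) = W1 R n f.
Proof.
under (eq_Ex (g := fun x => linpart f x ^+ 2)) => x.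
  rewrite expr2 {1}/linpart mulr_suml; over.
rewrite /= Ex_sum; apply: eq_bigr => i _.
under (eq_Ex (g := fun x => _ * _)) => x.
  rewrite /linpart mulr_sumr; over.
rewrite /= Ex_sum (bigD1 i) //= big1 ?addr0 => [|k /negPf ki].
  have E1 : Ex (fun x => chi i x * chi i x) = 1 by rewrite Ex_chi eqxx.
  rewrite expr2 -[RHS]mulr1 -[X in _ = _ * X]E1.
  by rewrite -ExZ; apply: eq_Ex => x; rewrite -/(fhat1 f i); ring.
transitivity (fhat1 f i * fhat1 f k * Ex (fun x => chi i x * chi k x)).
  by rewrite -ExZ; apply: eq_Ex => x; ring.
by rewrite Ex_chi eq_sym ki mulr0.
Qed.

Lemma fhat1_norm_le f i : `|fhat1 f i| <= 1.
Proof.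
rewrite fhat1E; apply: Ex_norm_le => x.
by rewrite normrM chi_norm mulr1 normr_nat /bval; case: (f x).
Qed.

Lemma linpart_norm_le f x : `|linpart f x| <= n%:R.
Proof.
apply: le_trans (ler_norm_sum _ _ _) _.
rewrite -[X in _ <= X%:R](card_ord n) -sumr_const ler_sum // => i _.
by rewrite normrM chi_norm mulr1 fhat1_norm_le.
Qed.

(** For noise [(1 - rho) / 2] the weight of a coordinate is [(1 + rho) / 2] or [(1 - rho) / 2],
    according to the sign [chi i x * chi i y]. *)
Lemma kernel_high rho x y :
  kernel ((1 - rho) / 2) x y =
  (2 ^+ n)^-1 * \prod_(i < n) (1 + rho * (chi i x * chi i y)).
Proof.
rewrite -exprVn -[X in _ ^+ X * _](card_ord n) -prodr_const -big_split.
apply: eq_bigr => i _; rewrite /chi /=.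
by case: (tnth x i); case: (tnth y i); rewrite /= ?expr0 ?expr1; field.
Qed.

Lemma noise_high f x rho : 0 <= rho <= 1 ->
  `|noise R n ((1 - rho) / 2) f x - (mean R n f + rho * linpart f x)|
    <= 4 ^+ n * rho ^+ 2.
Proof.
move=> rho01; have -> : noise R n ((1 - rho) / 2) f x =
    Ex (fun y => bval R n f y * \prod_(i < n) (1 + rho * (chi i x * chi i y))).
  rewrite noiseE /Defs.Ex mulr_sumr; apply: eq_bigr => y _.
  by rewrite kernel_high; ring.
have -> : linpart f x =
    Ex (fun y => bval R n f y * \sum_(i < n) chi i x * chi i y).
  rewrite /linpart; under eq_bigr => i _ do rewrite fhat1E mulrC -ExZ.
  by rewrite -Ex_sum; apply: eq_Ex => y; rewrite mulr_sumr; apply: eq_bigr => i _; ring.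
rewrite /mean -ExZ -ExD -ExB; apply: Ex_norm_le => y.
rewrite (_ : _ - _ = bval R n f y * (\prod_(i < n) (1 + rho * (chi i x * chi i y))
   - 1 - rho * \sum_(i < n) chi i x * chi i y)); last by ring.
rewrite normrM normr_nat.
have := @prod1D_approx R _ (index_enum 'I_n) (fun i => chi i x * chi i y) rho rho01.
have -> : size (index_enum 'I_n) = n by rewrite -[RHS](card_ord n) cardT enumT.
move=> h; apply: le_trans (h _) => [|i]; last by rewrite normrM !chi_norm mulr1.
by rewrite ler_piMl // /bval; case: (f y).
Qed.

(** The power is expanded around the mean, with [u] the relative deviation. Its linear term averages
    to 0 because noise preserves the mean, and its quadratic term produces [W1]. *)
Lemma Mfun_high a d (m : R) : 1 < a -> 0 < d -> 0 < m ->
  exists2 r : R, 0 < r <= 1 & forall rho, 0 < rho < r -> forall f,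
    mean R n f = m ->
    `|Mfun R n a ((1 - rho) / 2) f -
      powR m a * (1 + a * (a - 1) / 2 * (W1 R n f / m ^+ 2) * rho ^+ 2)|
      <= powR m a * (d * rho ^+ 2).
Proof.
move=> a1 d0 m0; pose c := a * (a - 1) / 2.
have c0 : 0 < c by rewrite divr_gt0 // mulr_gt0 //; lra.
pose C : R := 4 ^+ n; pose B : R := n%:R + C.
have C0 : 0 < C by rewrite exprn_gt0.
have n0 : 0 <= n%:R :> R by [].
have B0 : 0 < B by rewrite /B; lra.
have m20 : 0 < m ^+ 2 by rewrite exprn_gt0.
have B20 : 0 < (B / m) ^+ 2 by rewrite exprn_gt0 // divr_gt0.
have d10 : 0 < d / (2 * (B / m) ^+ 2) by rewrite divr_gt0 // mulr_gt0.
have [r1 r10 H1] := powR1D_taylor2 a d10.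
have K0 : 0 < 4 * c * B * C := mulr_gt0 (mulr_gt0 (mulr_gt0 (ltr0n R 4) c0) B0) C0.
(* The middle bound puts [u] in the range of the Taylor estimate, and the last one reduces the cubic
   error to half of the allowance. *)
pose r := Num.min 1 (Num.min (r1 / (B / m)) (d * m ^+ 2 / (4 * c * B * C))).
exists r.
  by rewrite !lt_min ge_min lexx ltr01 !divr_gt0 // mulr_gt0.
move=> rho; rewrite !lt_min => /andP[rho0 /and3P[rho1 rr1 rr2]] f fm.
have rho01 : 0 <= rho <= 1 by rewrite !ltW.
have r20 : 0 < rho ^+ 2 by rewrite exprn_gt0.
have e01 : 0 <= (1 - rho) / 2 <= 1 by apply/andP; split; lra.
set e := (1 - rho) / 2 in e01 *.
pose u x := (noise R n e f x - m) / m.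
have Nu x : noise R n e f x = m * (1 + u x) by rewrite /u; field; exact: lt0r_neq0.
have pt x : `|powR (1 + u x) a - 1 - a * u x - c / m ^+ 2 * rho ^+ 2 * linpart f x ^+ 2|
    <= d * rho ^+ 2.
  have Hw := noise_high f x rho01; rewrite fm -/e -/C in Hw.
  have Hl := linpart_norm_le f x.
  set N := noise R n e f x in Hw *; set l := linpart f x in Hw Hl *.
  have rl : `|rho * l| <= n%:R * rho.
    by rewrite normrM gtr0_norm // mulrC ler_wpM2r // ltW.
  have Nm : `|N - m| <= B * rho.
    have -> : N - m = (N - (m + rho * l)) + rho * l by ring.
    apply: le_trans (ler_normD _ _) _; rewrite /B mulrDl.
    have : C * rho ^+ 2 <= C * rho by rewrite ler_wpM2l ?ltW // expr2; nra.
    by lra.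
  have uB : `|u x| <= B / m * rho.
    rewrite /u -/N normrM normfV (gtr0_norm m0) mulrAC ler_wpM2r // invr_ge0 ltW //.
  have := H1 (u x); rewrite -/c => /(_ (le_lt_trans uB _)).
  rewrite mulrC -ltr_pdivlMr ?divr_gt0 // => /(_ rr1) HT.
  have HT' : d / (2 * (B / m) ^+ 2) * u x ^+ 2 <= d / 2 * rho ^+ 2.
    have u2 : u x ^+ 2 <= (B / m) ^+ 2 * rho ^+ 2.
      by rewrite -exprMn -(real_normK (num_real (u x))) lerXn2r ?nnegrE // (le_trans _ uB).
    apply: le_trans (ler_wpM2l (ltW d10) u2) _.
    rewrite le_eqVlt; apply/orP; left; apply/eqP; field.
    by rewrite !lt0r_neq0.
  (* Replacing [(N - m) ^+ 2] by [(rho * l) ^+ 2] costs a difference of squares, whose factors are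
     O(rho^2) and O(rho). *)
  have -> : powR (1 + u x) a - 1 - a * u x - c / m ^+ 2 * rho ^+ 2 * l ^+ 2 =
     (powR (1 + u x) a - 1 - a * u x - c * u x ^+ 2)
     + c / m ^+ 2 * ((N - (m + rho * l)) * ((N - m) + rho * l)).
    by rewrite /u -/N; field; exact: lt0r_neq0.
  apply: le_trans (ler_normD _ _) _.
  have cm0 : 0 <= c / m ^+ 2 by rewrite ltW // divr_gt0.
  have h : `|(N - (m + rho * l)) * ((N - m) + rho * l)| <=
      C * rho ^+ 2 * (2 * B * rho).
    rewrite normrM ler_pM // (le_trans (ler_normD _ _)) //.
    have : 0 <= C * rho by rewrite mulr_ge0 ?ltW.
    by move: Nm rl; rewrite /B mulrDl; lra.
  have h' : c / m ^+ 2 * (C * rho ^+ 2 * (2 * B * rho)) <= d / 2 * rho ^+ 2.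
    rewrite ltr_pdivlMr // in rr2.
    have -> : c / m ^+ 2 * (C * rho ^+ 2 * (2 * B * rho)) =
       (rho * (4 * c * B * C)) / m ^+ 2 / 2 * rho ^+ 2 by field; exact: lt0r_neq0.
    have h2 : rho * (4 * c * B * C) / m ^+ 2 <= d by rewrite ler_pdivrMr // ltW.
    by apply: (ler_wpM2r (ltW r20)); lra.
  rewrite normrM (ger0_norm cm0).
  have := ler_wpM2l cm0 h; lra.
have Eu : Ex u = 0.
  transitivity (m^-1 * (Ex (noise R n e f) - Ex (fun=> m))).
    by rewrite -ExB -ExZ; apply: eq_Ex => x; rewrite /u mulrC.
  by rewrite Ex_noise fm Ex_cst subrr mulr0.
have ME : Mfun R n a e f = powR m a * Ex (fun x => powR (1 + u x) a).
  rewrite /Mfun -ExZ; apply: eq_Ex => x.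
  have := noise_ge0 f x e01; rewrite Nu pmulr_rge0 // => u0.
  by rewrite powRM // ltW.
rewrite ME -mulrBr normrM ger0_norm ?powR_ge0 // ler_wpM2l ?powR_ge0 //.
have -> : Ex (fun x => powR (1 + u x) a) - (1 + c * (W1 R n f / m ^+ 2) * rho ^+ 2)
  = Ex (fun x => powR (1 + u x) a - 1 - a * u x - c / m ^+ 2 * rho ^+ 2 * linpart f x ^+ 2).
  by rewrite !ExB !ExZ Ex_cst Eu Ex_linpart_sqr; ring.
exact: Ex_norm_le.
Qed.

(** Each [2 ^+ n * fhat1 h i] is a sum of signs, hence an integer, and so is [4 ^+ n * W1 R n h]. *)
Lemma W1_gap f g : W1 R n f < W1 R n g -> 1 <= 4 ^+ n * (W1 R n g - W1 R n f).
Proof.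
have e4 : 4 ^+ n = (2 ^+ n) ^+ 2 :> R by rewrite -!natrX -expnM mulnC expnM.
have W1int h : 4 ^+ n * W1 R n h \is a Num.int.
  rewrite mulr_sumr rpred_sum // => i _.
  rewrite (_ : _ * _ = (2 ^+ n * fhat1 h i) ^+ 2); last first.
    by rewrite [RHS]exprMn e4.
  rewrite rpredX // fhat1E /Defs.Ex mulrA divff ?mul1r; last first.
    by rewrite lt0r_neq0 ?exprn_gt0.
  by rewrite rpred_sum // => x _; rewrite rpredM ?rpred_nat // rpredX // rpredN1.
rewrite -subr_gt0 => fg.
have : 0 < 4 ^+ n * (W1 R n g - W1 R n f) by rewrite mulr_gt0 ?exprn_gt0.
have : 4 ^+ n * (W1 R n g - W1 R n f) \is a Num.int by rewrite mulrBr rpredB.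
by move=> /intrP[z ->]; rewrite ltr0z ler1z.
Qed.

Lemma eq_W1 f g : f =1 g -> W1 R n f = W1 R n g.
Proof.
move=> fg; apply: eq_bigr => i _; congr (_ ^+ 2); apply: eq_Ex => x.
by rewrite /bval fg.
Qed.

Lemma Mfun_high_lt a (k : nat) : 1 < a ->
  exists2 r : R, 0 < r <= 1 & forall rho, 0 < rho < r -> forall f g,
    size_of f = k -> size_of g = k -> W1 R n f < W1 R n g ->
    Mfun R n a ((1 - rho) / 2) f < Mfun R n a ((1 - rho) / 2) g.
Proof.
move=> a1; case: k => [|k].
  (* The empty set is treated apart, since the expansion divides by the mean; here [f] and [g] agree
     and the strict inequality is impossible. *)
  exists 1; first by rewrite ltr01 lexx.
  move=> rho _ f g /size_of_eq0 f0 /size_of_eq0 g0.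
  by rewrite (@eq_W1 f g) ?ltxx // => x; rewrite f0 g0.
pose m : R := k.+1%:R / 2 ^+ n.
have m0 : 0 < m by rewrite divr_gt0 // exprn_gt0.
(* Up to the factor [powR m a], [c] is a lower bound for the gap between two distinct coefficients
   of [rho ^+ 2]; an error of [c / 4] on each side leaves half of it. *)
pose c := a * (a - 1) / 2 / m ^+ 2 / 4 ^+ n.
have a0 : 0 < a * (a - 1) / 2 by rewrite divr_gt0 // mulr_gt0 //; lra.
have c0 : 0 < c.
  exact: divr_gt0 (divr_gt0 a0 (exprn_gt0 2 m0)) (exprn_gt0 n (ltr0n R 4)).
have c40 : 0 < c / 4 by rewrite divr_gt0.
have [r r01 H] := Mfun_high a1 c40 m0; exists r => // rho rr f g fk gk fg.
have rho0 : 0 < rho ^+ 2 by case/andP: rr => ? _; rewrite exprn_gt0.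
have := H rho rr f; have := H rho rr g; rewrite !meanE fk gk.
move=> /(_ erefl) Hg /(_ erefl) Hf.
have p0 : 0 < powR m a by rewrite powR_gt0.
move: Hf Hg.
set F := Mfun _ _ _ _ f; set G := Mfun _ _ _ _ g.
have E h : a * (a - 1) / 2 * (W1 R n h / m ^+ 2) = c * (4 ^+ n * W1 R n h).
  by rewrite /c; field; rewrite !lt0r_neq0 ?exprn_gt0.
rewrite !E !ler_norml => /andP[_ Hf] /andP[Hg _].
have := W1_gap fg.
set wf := W1 R n f in Hf *; set wg := W1 R n g in Hg *; set q := 4 ^+ n in Hf Hg * => gap.
have h2 : 0 < powR m a * (c * rho ^+ 2) := mulr_gt0 p0 (mulr_gt0 c0 rho0).
have h1 : powR m a * (c * rho ^+ 2) * 1 <= powR m a * (c * rho ^+ 2) * (q * (wg - wf)).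
  exact: ler_wpM2l (ltW h2) _ _ gap.
lra.
Qed.

End HighNoise.

(** * Mean one half: dictators and their negations *)

Lemma dictatorE n (x : cube n.+1) : dictator n.+1 x = tnth x ord0.
Proof. by rewrite /dictator (tnth_nth false). Qed.

(** The lexicographic half is thus isometric to the dictator, which transfers the low-noise bound to
    it. *)
Lemma lexfun_half n (x : cube n.+1) :
  lexfun n.+1 (2 ^ n) x = ~~ dictator n.+1 x.
Proof.
rewrite dictatorE; elim/ccons_surj: x => b x.
by rewrite lexfun_ccons_small // tnth_ccons0 /lexfun lexrank_lt andbT.
Qed.

Lemma dictator_isometric n (f : boolfun n.+1) i c :
  (forall x, f x = tnth x i (+) c) ->
  exists2 s, cube_isometry s & f \o s =1 dictator n.+1.
Proof.
move=> fE; have [s si sE] := facet_isometry i c; exists s => //.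
apply: ccons_surj => b x /=.
by rewrite fE sE -addbA addbb addbF dictatorE tnth_ccons0.
Qed.

Section Dictator.
Variables (R : realType) (n : nat).
Implicit Types (f : boolfun n.+1).
Local Notation Ex := (Ex R n.+1).
Local Notation W1 := (W1 R n.+1).

Lemma size_of_dictator : size_of (dictator n.+1) = (2 ^ n)%N.
Proof.
rewrite (size_of_face true) (@eq_size_of _ (face true _) (fun=> true)); last first.
  by move=> x; rewrite /face dictatorE tnth_ccons0.
rewrite (@eq_size_of _ (face (~~ true) _) (fun=> false)); last first.
  by move=> x; rewrite /face dictatorE tnth_ccons0.
by rewrite !size_of_const mul1n addn0.
Qed.

(** Since [f] has values 0 and 1, [f - 1/2] has square 1/4; the linear part has mean 0, and its
    inner product with [f] is [W1 f]. *)
Lemma Ex_linear_residue f : mean R n.+1 f = 2^-1 ->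
  Ex (fun x => (bval R n.+1 f x - 2^-1 - linpart R f x) ^+ 2) = 4^-1 - W1 f.
Proof.
move=> fm.
have El : Ex (linpart R f) = 0.
  rewrite /linpart Ex_sum big1 // => i _; rewrite ExZ.
  have : Ex (chi R i) = - Ex (chi R i).
    rewrite {1}(Ex_flip i) -mulN1r -ExZ; apply: eq_Ex => x /=.
    by rewrite chi_flip eqxx.
  by move=> ?; have -> : Ex (chi R i) = 0; [lra | rewrite mulr0].
have Ef : Ex (fun x => bval R n.+1 f x * linpart R f x) = W1 f.
  transitivity (Ex (fun x => \sum_i fhat1 R f i * (bval R n.+1 f x * chi R i x))).
    apply: eq_Ex => x; rewrite /linpart mulr_sumr; apply: eq_bigr => i _; ring.
  rewrite Ex_sum; apply: eq_bigr => i _.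
  by rewrite ExZ -fhat1E -expr2.
transitivity (Ex (fun x => 4^-1 + linpart R f x ^+ 2
    - 2 * (bval R n.+1 f x * linpart R f x) + linpart R f x)).
  apply: eq_Ex => x; have : bval R n.+1 f x ^+ 2 = bval R n.+1 f x.
    by rewrite /bval; case: (f x); rewrite ?expr1n ?expr0n.
  move: (bval _ _ _ _) (linpart _ _ _) => b l bb.
  rewrite [LHS](_ : _ = b ^+ 2 - b + 4^-1 + l ^+ 2 - 2 * (b * l) + l); first by rewrite bb; ring.
  by field.
rewrite ExD ExB ExD ExZ Ex_cst Ef El Ex_linpart_sqr; ring.
Qed.

Lemma W1_half_le f : mean R n.+1 f = 2^-1 -> W1 f <= 4^-1.
Proof.
move=> /Ex_linear_residue; rewrite -subr_ge0 => <-.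
by rewrite -[0](Ex_cst n.+1) ler_Ex // => x; rewrite sqr_ge0.
Qed.

Lemma W1_dictator_ge : 4^-1 <= W1 (dictator n.+1).
Proof.
have -> : 4^-1 = fhat1 R (dictator n.+1) ord0 ^+ 2.
  rewrite fhat1E.
  have -> : Ex (fun x => bval R n.+1 (dictator n.+1) x * chi R ord0 x) =
      - mean R n.+1 (dictator n.+1).
    rewrite -mulN1r -ExZ; apply: eq_Ex => x.
    rewrite /bval /chi dictatorE; case: (tnth _ _) => /=; ring.
  rewrite meanE size_of_dictator natrX [2 ^+ n.+1]exprS; field.
  by rewrite lt0r_neq0 ?exprn_gt0.
rewrite /Defs.W1 (bigD1 ord0) //= lerDl sumr_ge0 // => i _; exact: sqr_ge0.
Qed.

(** The residue vanishes pointwise, so [f] is affine in the characters. Flipping a coordinate with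
    nonzero coefficient changes [f] at every point, and the sign of the change fixes the value. *)
Lemma W1_half_eq f : mean R n.+1 f = 2^-1 -> W1 f = 4^-1 ->
  exists i c, forall x, f x = tnth x i (+) c.
Proof.
move=> fm fW; have := Ex_linear_residue fm; rewrite fW subrr => /eqP.
rewrite mulf_eq0 invr_eq0 (negPf (lt0r_neq0 (exprn_gt0 n.+1 (ltr0n R 2)))) /=.
rewrite psumr_eq0 => [|x _]; last exact: sqr_ge0.
move=> /allP H.
have fE x : bval R n.+1 f x = 2^-1 + linpart R f x.
  have := H x; rewrite mem_index_enum => /(_ isT) /=.
  by rewrite sqrf_eq0 => /eqP; lra.
have [i ai] : exists i, fhat1 R f i != 0.
  apply/existsP; apply: contraT; rewrite negb_exists => /forallP a0.
  have : W1 f = 0.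
    rewrite /Defs.W1 big1 // => i _; have := a0 i; rewrite negbK /fhat1 => /eqP ->.
    by rewrite expr0n.
  by rewrite fW => /eqP; rewrite invr_eq0 pnatr_eq0.
(* A positive coefficient means that [f] is 1 where [chi R i] is 1, that is where bit [i] is
   [false]: the negated dictator. *)
exists i, (0 < fhat1 R f i) => x.
have D : bval R n.+1 f x - bval R n.+1 f (flip i x) = 2 * (fhat1 R f i * chi R i x).
  rewrite !fE opprD addrACA subrr add0r /linpart -sumrB (bigD1 i) //= big1.
    by rewrite chi_flip eqxx; ring.
  by move=> k /negPf ki; rewrite chi_flip ki mul1r subrr.
move: D; rewrite /bval /chi.
case: (ltgtP 0 (fhat1 R f i)) ai => // a0 _;
  case: (tnth x i); case: (f x); case: (f (flip i x)) => //=;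
  by rewrite ?expr0 ?expr1; lra.
Qed.

End Dictator.

Theorem theorem1 (R : realType) (n : nat) (alpha : R) (j : nat) :
  (1 <= n)%N -> 1 < alpha -> (j <= 2 ^ n)%N ->
  let m : R := j%:R / 2%:R ^+ n in
  (* (i) *)
  (exists eps0 : R, 0 < eps0 <= 2^-1 /\
     forall eps : R, 0 < eps < eps0 ->
       mean R n (lexfun n j) = m /\
       forall f : boolfun n, mean R n f = m ->
         Mfun R n alpha eps f <= Mfun R n alpha eps (lexfun n j)) /\
  (* (ii) *)
  (exists eps1 : R, 0 <= eps1 < 2^-1 /\
     forall eps : R, eps1 < eps < 2^-1 ->
       forall f : boolfun n, mean R n f = m ->
         (forall g : boolfun n, mean R n g = m -> Mfun R n alpha eps g <= Mfun R n alpha eps f) ->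
         forall g : boolfun n, mean R n g = m -> W1 R n g <= W1 R n f) /\
  (* (iii) *)
  (m = 2^-1 ->
   exists eps0 eps1 : R, 0 < eps0 <= 2^-1 /\ 0 <= eps1 < 2^-1 /\
     forall eps : R, (0 < eps < eps0) \/ (eps1 < eps < 2^-1) ->
       forall f : boolfun n, mean R n f = 2^-1 ->
         Mfun R n alpha eps f <= Mfun R n alpha eps (dictator n)).
Proof.
move=> n1 a1 jn m.
have low : exists eps0 : R, 0 < eps0 <= 2^-1 /\
     forall eps : R, 0 < eps < eps0 ->
       mean R n (lexfun n j) = m /\
       forall f : boolfun n, mean R n f = m ->
         Mfun R n alpha eps f <= Mfun R n alpha eps (lexfun n j).
  have [r r0 H] := Mfun_low n a1; exists (Num.min r 2^-1).
  rewrite lt_min r0 invr_gt0 ltr0n ge_min lexx orbT; split=> // eps.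
  rewrite lt_min => /andP[e0 /andP[er _]].
  split; first by apply/mean_eq; rewrite size_of_lexfun.
  move=> f /mean_eq fj.
  (* Either [f] attains the edge bound and is isometric to the segment, giving equality, or it loses
     at least one unit of [edges2] and the first-order comparison applies. *)
  have [fo|fo] := leqP (2 * lexedges j) (edges2 f).
    have {fo} : edge_optimal f.
      by apply/eqP; rewrite eqn_leq edges2_le fj.
    move=> /edge_optimal_isometric[s si]; rewrite fj => sE.
    by rewrite -(eq_Mfun _ _ sE) Mfun_isometry.
  apply: H; rewrite ?e0 ?size_of_lexfun //.
  by rewrite (lexfun_edge_optimal jn) size_of_lexfun.
have [r /andP[r0 r1] high] := Mfun_high_lt n j a1.
have highE eps : (1 - r) / 2 < eps < 2^-1 -> forall f g : boolfun n,
    size_of f = j -> size_of g = j -> W1 R n f < W1 R n g ->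
    Mfun R n alpha eps f < Mfun R n alpha eps g.
  (* Here [rho = 1 - 2 * eps], so [rho < r] amounts to [eps > (1 - r) / 2]. *)
  move=> /andP[e0 e1]; have -> : eps = (1 - (1 - 2 * eps)) / 2 by field.
  by apply: high; apply/andP; split; lra.
have eps1P : 0 <= (1 - r) / 2 < 2^-1 by apply/andP; split; lra.
split=> //; split.
  exists ((1 - r) / 2); split=> // eps eP f /mean_eq fj fmax g gm.
  rewrite leNgt; apply/negP => fg.
  have /mean_eq gj := gm.
  by have := highE eps eP f g fj gj fg; rewrite ltNge fmax.
move=> m2; case: low => eps0 [e0P low]; exists eps0, ((1 - r) / 2).
split=> //; split=> //.
case: n n1 @m jn low {high} highE m2 => // n _ m jn low highE m2.
have jE : j = (2 ^ n)%N.
  have : (2 * j%:R : R) = 2 ^+ n.+1.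
    have : m * 2 ^+ n.+1 = j%:R by rewrite divfK // lt0r_neq0 ?exprn_gt0.
    by rewrite m2 => <-; lra.
  move=> jE; apply/eqP; rewrite -(eqr_nat R) natrX; apply/eqP.
  by move: jE; rewrite exprS; lra.
have dm : size_of (dictator n.+1) = j by rewrite size_of_dictator.
have iso_dict eps (f : boolfun n.+1) : (exists i c, forall x, f x = tnth x i (+) c) ->
    Mfun R n.+1 alpha eps f = Mfun R n.+1 alpha eps (dictator n.+1).
  move=> [i [c /dictator_isometric [s si sE]]].
  by rewrite -(eq_Mfun _ _ sE) Mfun_isometry.
move=> eps [eP|eP] f fm.
  have [_ /(_ f)] := low eps eP; rewrite m2 => /(_ fm) fl.
  apply: le_trans fl _; rewrite jE (iso_dict _ (lexfun n.+1 (2 ^ n))) //.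
  by exists ord0, true => x; rewrite lexfun_half dictatorE addbT.
have fj : size_of f = j by apply/(@mean_eq R); rewrite fm -m2.
(* At weight 1/4, [f] is a dictator up to isometry and the values agree; below it, the dictator has
   strictly larger weight and wins. *)
have := W1_half_le fm; rewrite le_eqVlt => /orP[/eqP fW|fW].
  by rewrite (iso_dict _ f) //; apply: W1_half_eq fm fW.
by apply: ltW; apply: highE => //; apply: lt_le_trans fW (W1_dictator_ge _ _).
Qed.
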